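(* Let $T>0$, let $a,b,c:(0,T)\times(0,1)\to\mathbb{R}$ and $f:(0,T]\times(0,1)\to\mathbb{R}$ be functions with $\sup_{0<x<1,\,0<t\le T}|f(t,x)|<+\infty$. Let $u\in C^0([0,T]\times[0,1])$ be such that $u[t]\in C^2((0,1))$ for almost all $t\in(0,T)$, the derivative $\frac{\partial u}{\partial t}(t,x)$ exists and is a continuous function on $(0,T)\times[0,1]$, and $$\frac{\partial u}{\partial t}(t,x)=a(t,x)\frac{\partial^2u}{\partial x^2}(t,x)+b(t,x)\frac{\partial u}{\partial x}(t,x)+c(t,x)u(t,x)+f(t,x)$$ for almost all $t\in(0,T)$ and for all $x\in(0,1)$. Suppose that $a(t,x)\ge 0$ for all $t\in(0,T)$, $x\in(0,1)$, and that there exist a constant $\sigma>0$ and a positive function $\eta\in C^2([0,1];(0,+\infty))$ such that $$a(t,x)\eta''(x)+b(t,x)\eta'(x)+(\sigma+c(t,x))\eta(x)\le 0\quad\text{for all } t\in(0,T),\ x\in(0,1).$$ Then for all $\zeta\in[0,\sigma)$ and $t\in(0,T]$: $$\|u[t]\|_{\infty,\eta}\le\max\left(\exp(-\zeta t)\|u[0]\|_{\infty,\eta},\ \sup_{0<s\le t}\left(\max\left(\frac{|u(s,0)|}{\eta(0)},\frac{|u(s,1)|}{\eta(1)},\frac{\|f[s]\|_{\infty,\eta}}{\sigma-\zeta}\right)\exp(-\zeta(t-s))\right)\right),$$ where $\|u[t]\|_{\infty,\eta}:=\max_{0\le x\le1}\frac{|u(t,x)|}{\eta(x)}$ and $\|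f[t]\|_{\infty,\eta}:=\sup_{0<x<1}\frac{|f(t,x)|}{\eta(x)}$.
   Context: For a function $u$ of $(t,x)$, $u[t]$ denotes the profile at time $t$, i.e. $(u[t])(x)=u(t,x)$; similarly for $f[t]$. $C^k(U;\Omega)$ denotes the class of functions on $U$ with values in $\Omega$ having continuous derivatives up to order $k$ on $U$; $C^k(U)=C^k(U;\mathbb{R})$. ''Almost all'' refers to Lebesgue measure. $\eta',\eta''$ are derivatives with respect to $x\in[0,1]$. *)

(* Defs.v *)
From HB Require Import structures.
From mathcomp Require Import all_boot all_order all_algebra.
From mathcomp Require Import all_classical all_reals all_analysis.
Import Order.TTheory GRing.Theory Num.Theory.
Import numFieldNormedType.Exports.

Set Implicit Arguments.
Unset Strict Implicit.
Unset Printing Implicit Defensive.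

Local Open Scope ring_scope.
Local Open Scope classical_set_scope.

(** A function on a subset [U] of the line is represented by a total function
    whose values outside [U] are irrelevant.  The derivative relative to [U]
    never looks at those values: it is two-sided at interior points of [U] and
    one-sided at an endpoint that belongs to [U]. *)
Definition diff_quot {R : realType} (f : R -> R) (x : R) : R -> R :=
  fun y => (f y - f x) / (y - x).

Definition derivable_within {R : realType} (U : set R) (f : R -> R) (x : R) :=
  cvg (diff_quot f x @ within U x^').

Definition derive_within {R : realType} (U : set R) (f : R -> R) : R -> R :=
  fun x => lim (diff_quot f x @ within U x^').

Definition derive_within_n {R : realType} (U : set R) (n : nat) (f : R -> R) :=
  iter n (derive_within U) f.

Definition classC {R : realType} (k : nat) (U : set R) (f : R -> R) : Prop :=
  (forall j x, (j < k)%N -> U x ->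
     derivable_within U (derive_within_n U j f) x) /\
  (forall j, (j <= k)%N -> {within U, continuous (derive_within_n U j f)}).

(** When [D] is [`[0, 1]] and [g], [eta] are continuous on it with [eta]
    positive, this supremum is attained, hence is a maximum. *)
Definition wnorm {R : realType} (eta : R -> R) (D : set R) (g : R -> R) : R :=
  sup [set `|g x| / eta x | x in D].

Lemma within_dnbhs {R : realType} (U : set R) (x : R) :
  nbhs x U -> within U x^' = x^'.
Proof.
move=> Ux; apply/seteqP; split => A; rewrite /within /=.
  move=> h; near=> y; apply: (near h y) => //.
  by near: y; exact: nbhs_dnbhs.
by move=> h; near=> y => _; near: y.
Unshelve. all: by end_near. Qed.

Lemma diff_quot_dnbhs {R : realType} (f : R -> R) (x : R) :
  diff_quot f x @ x^' = (fun h => h^-1 *: (f (h + x) - f x)) @ 0^'.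
Proof.
have -> : (fun h => h^-1 *: (f (h + x) - f x)) = diff_quot f x \o shift x.
  by apply/funext => h; rewrite /diff_quot /= addrK mulrC.
apply/seteqP; split => A.
  move=> /nbhs_ballP[r /= r0 hr]; apply/nbhs_ballP; exists r => //= h hb h0.
  apply: hr; rewrite /ball /=.
    by move: hb; rewrite /ball /= sub0r normrN opprD addrCA subrr addr0 normrN.
  by apply: contra h0 => /eqP/(canRL (addrK x)); rewrite subrr => ->.
move=> /nbhs_ballP[r /= r0 hr]; apply/nbhs_ballP; exists r => //= y yb yx.
have := hr (y - x); rewrite /= subrK; apply; last by rewrite subr_eq0.
by move: yb; rewrite /ball /= sub0r opprB.
Qed.

(** At interior points the relative derivatives are the usual ones. *)
Lemma derivable_within_nbhs {R : realType} (U : set R) (f : R -> R) (x : R) :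
  nbhs x U -> derivable_within U f x <-> derivable f x 1.
Proof.
move=> Ux; rewrite /derivable_within (within_dnbhs Ux) diff_quot_dnbhs.
rewrite /derivable.
suff -> : (fun h => h^-1 *: (f (h + x) - f x)) =
  (fun h => h^-1 *: ((f \o shift x) (h *: 1) - f x)) by split; exact: id.
by apply/funext => h; rewrite /= [h *: 1]mulr1.
Qed.

Lemma derive_within_nbhs {R : realType} (U : set R) (f : R -> R) (x : R) :
  nbhs x U -> derive_within U f x = f^`() x.
Proof.
by move=> Ux; rewrite /derive_within (within_dnbhs Ux) diff_quot_dnbhs.
Qed.

Lemma derive_within_n_nbhs {R : realType} (U : set R) (n : nat) (f : R -> R)
  (x : R) : nbhs x U -> derive_within_n U n f x = f^`(n) x.
Proof.
elim: n x => [//|n IH] x Ux.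
have -> : derive_within_n U n.+1 f x =
  derive_within U (derive_within_n U n f) x by [].
rewrite (derive_within_nbhs _ Ux) derive1nS !derive1E; apply: near_eq_derive.
by apply: filterS (nbhs_interior Ux) => y; exact: IH.
Qed.

(* Main.v *)
Require Import Defs.
From HB Require Import structures.
From mathcomp Require Import all_boot all_order all_algebra.
From mathcomp Require Import all_classical all_reals all_analysis.
From mathcomp Require Import ring lra.
Import Order.TTheory GRing.Theory Num.Theory.
Import numFieldNormedType.Exports.

(** The quantity to control is v(s,x) = u(s,x) exp(zeta s) / eta(x), for u and
    for -u.  Let K be exp(zeta t) times the right-hand side of the estimate.
    By construction v <= K at time 0 and on the lateral boundary up to time t,
    and f exp(zeta s) / eta <= (sigma - zeta) K inside; the claim is that
    v <= K persists up to time t.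

    At a time s at which the equation holds, let x be an interior maximiser of
    v(s,.) with v(s,x) > K.  With m = u(s,x) / eta(x), the function u(s,.) - m eta
    has a maximum at x, so its first derivative vanishes there and its second
    derivative is nonpositive.  Since a >= 0 and eta is a supersolution, the
    spatial operator applied to u is at most -sigma u there
    ([operator_at_weighted_max]), whence
    dv/ds <= -(sigma - zeta) (v - K) < 0.

    The equation is only known for almost every s, but such times are dense
    ([ae_exists_itv]), and both v and dv/ds are continuous up to x = 0 and
    x = 1.  By compactness of [0,1], the times s for which SOME maximiser x of
    v(s,.) satisfies the decay inequality form a closed set
    ([closed_times_of_argmax]); hence every time at which max v(s,.) > K has
    such a maximiser ([positive_maximizer_decreases]).  If v exceeded K somewhere,
    take the maximum of v up to that time; at the time where it is attained some
    maximiser in space has dv/ds < 0, so v was larger just before, a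
    contradiction ([parabolic_comparison]). *)

Local Open Scope ring_scope.
Local Open Scope classical_set_scope.

(** * Derivatives at a maximum *)

Lemma is_derive_gt0_sign {R : realType} {f : R -> R} {c d : R} :
  is_derive c 1 f d -> 0 < d ->
  exists2 r, 0 < r & forall y, 0 < `|y - c| < r -> 0 < (y - c) * (f y - f c).
Proof.
move=> [df dE] d0.
have : h^-1 *: ((f \o shift c) (h *: 1) - f c) @[h --> 0^'] --> d.
  by rewrite -dE; exact: df.
move=> /cvgr_gt/(_ _ d0)/nbhs_ballP[r /= r0 hr].
exists r => // y /andP[y0 yr].
have ync : y - c != 0 by rewrite -normr_gt0.
have := hr (y - c); rewrite /ball/= sub0r normrN => /(_ yr ync).
rewrite /GRing.scale/= mulr1 subrK => h.
have -> : (y - c) * (f y - f c) = (y - c) ^+ 2 * ((y - c)^-1 * (f y - f c)).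
  by rewrite expr2 -mulrA mulVKf.
by rewrite mulr_gt0// exprn_even_gt0.
Qed.

(** If [d2] were positive, [dphi], which vanishes at [c], would be positive just
    to the right of [c], and [phi] would increase there. *)
Lemma second_derivative_test {R : realType} {phi dphi : R -> R} {a b c d2 : R} :
  (forall x, a < x < b -> is_derive x 1 phi (dphi x)) ->
  a < c < b -> is_derive c 1 dphi d2 ->
  (forall x, a < x < b -> phi x <= phi c) ->
  dphi c = 0 /\ d2 <= 0.
Proof.
move=> dphiP acb d2P cmax.
have d0 : dphi c = 0.
  have := dphiP c acb.
  have [||||_ <-] := @derive1_at_max R phi a b c.
  - by move/andP: acb => [ac cb]; exact/ltW/(lt_trans ac).
  - by move=> t; rewrite in_itv/= => /dphiP[].
  - by rewrite in_itv.
  - by move=> t; rewrite in_itv/= => /cmax.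
  by move=> [_ <-].
split=> //; rewrite leNgt; apply/negP => d2gt0.
have [r r0 hr] := is_derive_gt0_sign d2P d2gt0.
move: acb => /andP[ac cb].
(* a point to the right of [c] at which [phi] would exceed its maximum *)
pose e := Num.min (r / 2) ((b - c) / 2).
have e0 : 0 < e by rewrite lt_min !divr_gt0// subr_gt0.
have er : e < r by rewrite gt_min; apply/orP; left; lra.
have ecb : c + e < b.
  rewrite -ltrBrDl gt_min; apply/orP; right.
  by rewrite ltr_pdivrMr// mulr_natr mulr2n ltrDl subr_gt0.
have inab x : x \in `[c, (c + e)]%R -> a < x < b.
  by rewrite in_itv/= => /andP[? ?]; apply/andP; split; lra.
have inoab x : x \in `]c, (c + e)[%R -> a < x < b.
  by rewrite in_itv/= => /andP[? ?]; apply/andP; split; lra.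
have /le_lt_trans : phi (c + e) <= phi c.
  by apply/cmax/inab; rewrite in_itv/= lexx lerDl ltW.
have: phi c < phi (c + e).
  apply: (@gtr0_derive1_lt_cc _ phi c (c + e)).
  - by move=> x /inoab/dphiP[].
  - move=> x xc; rewrite derive1E; have [_ ->] := dphiP x (inoab x xc).
    move: xc; rewrite in_itv/= => /andP[cx xce].
    have xc0 : 0 < x - c by rewrite subr_gt0.
    have := hr x; rewrite gtr0_norm// xc0 d0 subr0 pmulr_rgt0//; apply.
    by rewrite ltrBlDl (lt_trans xce)// ltrD2l.
  - by apply: derivable_within_continuous => x /inab/dphiP[].
  - by rewrite in_itv/= lexx lerDl ltW.
  - by rewrite in_itv/= lexx lerDl ltW.
  - by rewrite ltrDl.
by move=> /[swap] /[apply]; rewrite ltxx.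
Qed.

(** * Continuity and compactness on subsets *)

Lemma within_continuous_comp_maps {U V W : topologicalType} {A : set V}
    {B : set U} {f : V -> W} {g : U -> V} :
  {within A, continuous f} -> {within B, continuous g} ->
  (forall x, B x -> A (g x)) -> {within B, continuous (f \o g)}.
Proof.
move=> /subspace_continuousP cf /subspace_continuousP cg BA.
apply/subspace_continuousP => x Bx; apply: cvg_trans (cf _ (BA x Bx)).
move=> P /= hP; have := cg x Bx _ hP; rewrite /nbhs/= /within/= => hB.
near=> y => By; apply: (near hB y) => //; exact: BA.
Unshelve. all: by end_near. Qed.

Lemma closed_within_le0 {R : realType} {T : topologicalType} (A : set T)
    (f : T -> R) :
  closed A -> {within A, continuous f} -> closed (A `&` [set x | f x <= 0]).
Proof.
move=> cA /continuous_closedP cf.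
have := cf _ (@closed_le R 0); rewrite -(closed_setSI _ cA); exact.
Qed.

(** Being a maximiser of [g (s, _)] and satisfying [h <= 0] are closed conditions
    on the pair [(s, x)], and projecting a closed subset of [A `*` K] along the
    compact [K] gives a closed set.  This is how an inequality known at the
    maximisers for a dense set of times reaches every time, though only for some
    maximiser. *)
Lemma closed_times_of_argmax {R : realType} {S X : topologicalType}
    (A : set S) (K : set X) (g h : S * X -> R) :
  hausdorff_space S -> compact A -> compact K -> closed K ->
  {within A `*` K, continuous g} -> {within A `*` K, continuous h} ->
  closed [set s | A s /\ exists x,
     [/\ K x, forall y, K y -> g (s, y) <= g (s, x) & h (s, x) <= 0]].
Proof.
move=> hS cA cK clK cg ch.
have clA := compact_closed hS cA.
have clQ : closed (A `*` K).
    have -> : A `*` K = fst @^-1` A `&` snd @^-1` K by [].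
    apply: closedI; apply: closed_comp => // p _;
      [exact: cvg_fst|exact: cvg_snd].
pose Z := (A `*` K `&` [set p | h p <= 0]) `&`
  \bigcap_(y in K) (A `*` K `&` [set p | g (p.1, y) - g p <= 0]).
have cZ : compact Z.
  apply: (subclosed_compact _ (compact_setX cA cK)); last by move=> p [[]].
  apply: closedI; first exact: closed_within_le0.
  apply: closed_bigI => y Ky; apply: closed_within_le0 => //.
  apply: within_continuousB => //.
  apply: (within_continuous_comp_maps (g := fun p : S * X => (p.1, y)) cg).
    apply: continuous_subspaceT => p; apply: cvg_pair => /=; first exact: cvg_fst.
    exact: cvg_cst.
  by move=> p [].
suff -> : [set s | A s /\ exists x,
     [/\ K x, forall y, K y -> g (s, y) <= g (s, x) & h (s, x) <= 0]] =
     fst @` Z.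
  apply: (compact_closed hS); apply: continuous_compact => //.
  by apply: continuous_subspaceT => p; exact: cvg_fst.
apply/seteqP; split=> s /=.
  move=> [As [x [Kx gx hx]]]; exists (s, x) => //; split=> // y Ky; split=> //=.
  by rewrite subr_le0 gx.
move=> [[s' x] [[[As Kx] hx] gx] <-] /=; split=> //; exists x; split=> // y Ky.
by have [_ /=] := gx y Ky; rewrite subr_le0.
Qed.

(** A null set contains no nonempty open interval: this density is all that is
    ever used of a property holding almost everywhere. *)
Lemma ae_exists_itv {R : realType} {P : R -> Prop} {p q : R} :
  {ae lebesgue_measure, forall t : R, P t} -> p < q ->
  exists2 t, p < t < q & P t.
Proof.
move=> aeP pq; apply: contrapT => noP.
have : (@lebesgue_measure R) `]p, q[%classic = 0%E.
  apply: measure_negligible => //; apply: negligibleS aeP => t /=.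
  by rewrite in_itv/= => tpq Pt; apply: noP; exists t.
rewrite lebesgue_measure_itv/= lte_fin pq -EFinB => -[] /eqP.
by rewrite subr_eq0 => /eqP qp; rewrite qp ltxx in pq.
Qed.

Lemma within_continuous_slicel {S X W : topologicalType} {A : set S}
    {K : set X} {g : S -> X -> W} {s : S} :
  {within A `*` K, continuous (fun p => g p.1 p.2)} -> A s ->
  {within K, continuous (g s)}.
Proof.
move=> cg As.
apply: (within_continuous_comp_maps (g := fun x : X => (s, x)) cg) => //.
by apply: continuous_subspaceT => x; apply: cvg_pair => /=; [exact: cvg_cst|].
Qed.

Lemma within_continuous_slicer {S X W : topologicalType} {A : set S}
    {K : set X} {g : S -> X -> W} {x : X} :
  {within A `*` K, continuous (fun p => g p.1 p.2)} -> K x ->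
  {within A, continuous (g ^~ x)}.
Proof.
move=> cg Kx.
apply: (within_continuous_comp_maps (g := fun s : S => (s, x)) cg) => //.
by apply: continuous_subspaceT => s; apply: cvg_pair => /=; [|exact: cvg_cst].
Qed.

(** * Comparison from decay at spatial maxima *)

Section parabolic_comparison.
Context {R : realType} {T delta : R} {w wt : R -> R -> R}.
Hypotheses (T0 : 0 < T) (delta0 : 0 < delta).
Hypothesis cw :
  {within `[0, T] `*` `[0, 1], continuous (fun p : R * R => w p.1 p.2)}.
Hypothesis cwt :
  {within `]0, T[ `*` `[0, 1], continuous (fun p : R * R => wt p.1 p.2)}.
Hypothesis dw : forall s x, 0 < s < T -> 0 <= x <= 1 ->
  is_derive s 1 (w ^~ x) (wt s x).
Hypothesis w_init : forall x, 0 <= x <= 1 -> w 0 x <= 0.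
Hypothesis w_left : forall s, 0 < s < T -> w s 0 <= 0.
Hypothesis w_right : forall s, 0 < s < T -> w s 1 <= 0.
(* Density of the times [s] is what a differential equation that holds for
   almost every time provides. *)
Hypothesis dense_decay : forall p q, 0 <= p -> p < q -> q <= T ->
  exists2 s, p < s < q & forall x, 0 < x < 1 -> 0 < w s x ->
    (forall y, 0 <= y <= 1 -> w s y <= w s x) -> wt s x <= - delta * w s x.

Lemma slice_maximizer s : 0 < s < T -> exists2 x, 0 <= x <= 1 &
  forall y, 0 <= y <= 1 -> w s y <= w s x.
Proof.
move=> /andP[s0 sT].
have cs : {within `[0, 1], continuous (w s)}.
  by apply: (within_continuous_slicel cw); rewrite /= in_itv/= !ltW.
have [x + xmax] := EVT_max ler01 cs.
by rewrite in_itv/= => x01; exists x => // y y01; apply: xmax; rewrite in_itv.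
Qed.

(** Dense times suffice: just before [s] the function is still positive at [x0],
    so every spatial maximiser there is positive, hence interior, and decays; the
    inequality passes to the limit by [closed_times_of_argmax]. *)
Lemma positive_maximizer_decreases s x0 : 0 < s < T -> 0 <= x0 <= 1 ->
  0 < w s x0 ->
  exists x, [/\ 0 <= x <= 1, forall y, 0 <= y <= 1 -> w s y <= w s x
             & wt s x + delta * w s x <= 0].
Proof.
move=> /andP[s0 sT] x001 wpos.
(* a compact window around [s] that stays inside the open time interval, where
   [wt] is continuous *)
pose A := `[s / 2, (s + T) / 2]%classic : set R.
have A0T : A `<=` `]0, T[.
  move=> r; rewrite /A/= !in_itv/= => /andP[? ?].
  by apply/andP; split; lra.
have A0Tc : A `<=` `[0, T] by move=> r /A0T; exact: subset_itv_oo_cc.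
have cAw : {within A `*` `[0, 1], continuous (fun p : R * R => w p.1 p.2)}.
  by apply: continuous_subspaceW cw; exact: setSX.
have cAwt : {within A `*` `[0, 1], continuous
    (fun p : R * R => wt p.1 p.2 + delta * w p.1 p.2)}.
  move=> p; apply: cvgD.
    by apply: (continuous_subspaceW _ cwt) => //; exact: setSX.
  by apply: cvgM; [exact: cvg_cst|exact: cAw].
have clZ := @closed_times_of_argmax R R R A `[0, 1] (fun p => w p.1 p.2) _
  (@Rhausdorff R) (@segment_compact _ _ _) (@segment_compact _ _ _)
  (@itv_closed _ _ _ _) cAw cAwt.
have [|_ [x [/= x01 xmax wtx]]] := clZ s; last first.
  by exists x; split => // y y01; apply: xmax; rewrite in_itv.
move=> B sB.
have cs : {for s, continuous (w ^~ x0)}.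
  apply: (within_continuous_continuous T0); last by rewrite in_itv/= s0.
  by apply: (within_continuous_slicer cw); rewrite /= in_itv.
have : \forall r \near s, B r /\ 0 < w r x0.
  by apply: filterI => //; exact: (cvgr_gt _ cs).
move=> /nbhs_ballP[e /= e0 he].
have [|||s' /andP[ps' s's] decays'] := dense_decay (Num.max (s / 2) (s - e)) s.
- by rewrite le_max divr_ge0// ltW.
- by rewrite gt_max; apply/andP; split; lra.
- exact: ltW.
move: ps'; rewrite gt_max => /andP[s2s' ses'].
have s'0T : 0 < s' < T by apply/andP; split; lra.
have [|Bs' ws'] := he s'.
  by rewrite /ball/= ger0_norm; lra.
have [x x01 xmax] := slice_maximizer s' s'0T.
have wx : 0 < w s' x by exact: lt_le_trans (xmax _ x001).
exists s'; split => //=; split.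
  by rewrite /A/= in_itv/=; apply/andP; split; lra.
exists x; split; rewrite /= ?in_itv//=.
rewrite -lerBrDr sub0r -mulNr.
apply: decays' => //; move: x01; rewrite !le_eqVlt => /andP[/predU1P[xE|->]].
  by move: wx; rewrite -xE ltNge w_left.
move=> /predU1P[x1|->//].
by move: wx; rewrite x1 ltNge w_right.
Qed.

(** Maximise [w] over the rectangle up to time [s].  If the maximum is positive,
    at the time where it is reached some spatial maximiser has [wt < 0], so [w]
    took a larger value shortly before. *)
Lemma parabolic_comparison_lt s x : 0 <= s < T -> 0 <= x <= 1 -> w s x <= 0.
Proof.
move=> /andP[s0 sT] x01; rewrite leNgt; apply/negP => wpos.
pose Q := (`[0, s] `*` `[0, 1])%classic : set (R * R).
have QT : Q `<=` `[0, T] `*` `[0, 1].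
  apply: setSX => r /=; rewrite !in_itv/= => /andP[? ?];
    by apply/andP; split; lra.
have [|||[r y] + mx] := @compact_EVT_max _ R (fun p : R * R => w p.1 p.2) Q.
- by exists (s, x); split; rewrite /= in_itv/= ?s0 ?lexx.
- by apply: compact_setX; exact: segment_compact.
- exact: continuous_subspaceW QT cw.
rewrite inE => -[]; rewrite /= !in_itv/= => /andP[r0 rs] y01.
have {}mx p z : 0 <= p <= s -> 0 <= z <= 1 -> w p z <= w r y.
  by move=> ps z01; apply: (mx (p, z)); rewrite inE; split; rewrite /= in_itv.
have wry : 0 < w r y by apply: lt_le_trans wpos (mx _ _ _ _) => //; rewrite s0/=.
have {}r0 : 0 < r.
  rewrite lt_neqAle r0 andbT; apply/eqP => r0'; move: wry.
  by rewrite -r0' ltNge w_init.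
have r0T : 0 < r < T by rewrite r0 (le_lt_trans rs).
have [z [z01 zmax wtz]] := positive_maximizer_decreases r y r0T y01 wry.
have wrz : 0 < w r z by exact: lt_le_trans (zmax _ y01).
have dwz : is_derive r 1 (- (w ^~ z)) (- wt r z).
  by have := dw r z r0T z01 => ?; exact: is_deriveN.
have [|e e0 he] := is_derive_gt0_sign dwz.
  have dw0 : 0 < delta * w r z by exact: mulr_gt0.
  by rewrite oppr_gt0; lra.
pose d := Num.min (e / 2) (r / 2).
have d0 : 0 < d by rewrite lt_min !divr_gt0.
have de : d < e by rewrite gt_min; apply/orP; left; lra.
have dr : d < r by rewrite gt_min; apply/orP; right; lra.
have := he (r - d).
rewrite addrAC subrr add0r normrN gtr0_norm// d0 de => /(_ isT).
rewrite nmulr_rgt0 ?oppr_lt0//.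
change (- w (r - d) z - - w r z < 0 -> False).
have h1 : w (r - d) z <= w r y by apply: mx => //; apply/andP; split; lra.
have h2 := zmax y y01.
lra.
Qed.

(** The time derivative of [w] is only controlled before [T]; the final time is
    reached by continuity. *)
Lemma parabolic_comparison s x : 0 <= s <= T -> 0 <= x <= 1 -> w s x <= 0.
Proof.
move=> /andP[s0]; rewrite le_eqVlt => /predU1P[->|sT] x01; last first.
  by apply: parabolic_comparison_lt => //; rewrite s0.
have : {within `[0, T], continuous (w ^~ x)}.
  by apply: (within_continuous_slicer cw); rewrite /= in_itv.
move=> /(continuous_within_itvP _ T0)[_ _ wT].
rewrite -(cvg_lim _ wT)//; apply: limr_le; first by apply/cvg_ex; exists (w T x).
near=> r; apply: parabolic_comparison_lt => //; apply/andP; split=> //.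
by near: r; exact: nbhs_left_ge.
Unshelve. all: by end_near. Qed.

End parabolic_comparison.

(** * The estimate for one sign *)

Lemma classC2_is_derive {R : realType} {U : set R} {f : R -> R} {x : R} :
  nbhs x U -> classC 2 U f ->
  is_derive x 1 f (derive1 f x) /\ is_derive x 1 (derive1 f) (derive1n 2 f x).
Proof.
move=> Ux [df _]; have Uxx := nbhs_singleton Ux; split.
  apply: DeriveDef; last by rewrite derive1E.
  exact: (derivable_within_nbhs f Ux).1 (df 0%N x isT Uxx).
apply: DeriveDef; last by rewrite -derive1E.
apply: (@near_eq_derivable _ _ _ (derive_within U f)).
  by apply: filterS (nbhs_interior Ux) => y Uy; exact: derive_within_nbhs.
exact: (derivable_within_nbhs _ Ux).1 (df 1%N x isT Uxx).
Qed.

(** With [m := v x / eta x], the function [v - m *: eta] is maximal, and zero, at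
    [x].  Replacing [v] by [m *: eta] therefore keeps the terms of order zero and
    one and can only increase the second-order term; the supersolution inequality
    for [eta] then applies, multiplied by [m >= 0]. *)
Lemma operator_at_weighted_max {R : realType} {v dv eta deta : R -> R}
    {x d2v d2eta alpha beta gamma sigma : R} :
  (forall y : R, 0 < y < 1 -> is_derive y 1 v (dv y)) ->
  (forall y : R, 0 < y < 1 -> is_derive y 1 eta (deta y)) ->
  (forall y : R, 0 < y < 1 -> 0 < eta y) ->
  0 < x < 1 -> is_derive x 1 dv d2v -> is_derive x 1 deta d2eta ->
  0 <= v x -> (forall y : R, 0 < y < 1 -> v y / eta y <= v x / eta x) ->
  0 <= alpha ->
  alpha * d2eta + beta * deta x + (sigma + gamma) * eta x <= 0 ->
  alpha * d2v + beta * dv x + gamma * v x <= - sigma * v x.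
Proof.
move=> dvP detaP eta0 x01 d2vP d2etaP vx0 vmax alpha0 ineq.
pose m := v x / eta x.
have m0 : 0 <= m by rewrite divr_ge0// ltW// eta0.
have vxE : v x = m * eta x by rewrite divfK// gt_eqF// eta0.
have dphi (y : R) : 0 < y < 1 ->
    is_derive y 1 (v - m \*: eta) ((dv - m \*: deta) y).
  by move=> y01; have ? := dvP y y01; have ? := detaP y y01; exact: is_deriveB.
have d2phi : is_derive x 1 (dv - m \*: deta) (d2v - m *: d2eta).
  exact: is_deriveB.
have [] := second_derivative_test dphi x01 d2phi.
  move=> y y01; change (v y - m * eta y <= v x - m * eta x).
  by rewrite vxE subrr subr_le0 -ler_pdivrMr ?eta0// vmax.
change (dv x - m * deta x = 0 -> d2v - m * d2eta <= 0 ->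
  alpha * d2v + beta * dv x + gamma * v x <= - sigma * v x).
move=> /eqP; rewrite subr_eq0 => /eqP -> h2.
have := mulr_ge0_le0 alpha0 h2; have := mulr_ge0_le0 m0 ineq.
rewrite vxE; nra.
Qed.

Section one_sided_bound.
Context {R : realType} {T : R} {a b c f u : R -> R -> R}
  {eta : R -> R} {sigma zeta : R}.
Hypothesis T0 : 0 < T.
Hypothesis cu :
  {within `[0, T] `*` `[0, 1], continuous (fun p : R * R => u p.1 p.2)}.
Hypothesis uC2 : {ae lebesgue_measure, forall t : R,
  0 < t < T -> classC 2 `]0, 1[ (u t)}.
Hypothesis du : forall t x : R,
  0 < t < T -> 0 <= x <= 1 -> derivable (u ^~ x) t 1.
Hypothesis cdu : {within `]0, T[ `*` `[0, 1],
  continuous (fun p : R * R => derive1 (u ^~ p.2) p.1)}.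
Hypothesis pde : {ae lebesgue_measure, forall t : R, 0 < t < T ->
  forall x : R, 0 < x < 1 -> derive1 (u ^~ x) t =
    a t x * derive1n 2 (u t) x + b t x * derive1 (u t) x
    + c t x * u t x + f t x}.
Hypothesis a_ge0 : forall t x : R, 0 < t < T -> 0 < x < 1 -> 0 <= a t x.
Hypothesis etaC2 : classC 2 `[0, 1] eta.
Hypothesis eta_gt0 : forall x : R, 0 <= x <= 1 -> 0 < eta x.
Hypothesis eta_super : forall t x : R, 0 < t < T -> 0 < x < 1 ->
  a t x * derive1n 2 eta x + b t x * derive1 eta x
  + (sigma + c t x) * eta x <= 0.
Hypothesis zeta_lt : zeta < sigma.

(** The factor [e] will be 1 and -1: the hypotheses on the coefficients and on
    [eta] are insensitive to the sign of [u], so one proof covers both the upper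
    and the lower bound. *)
Lemma one_sided_bound (e K : R) : 0 <= K ->
  (forall x, 0 <= x <= 1 -> e * u 0 x / eta x <= K) ->
  (forall s x, 0 < s < T -> x = 0 \/ x = 1 ->
     e * u s x / eta x * expR (zeta * s) <= K) ->
  (forall s x, 0 < s < T -> 0 < x < 1 ->
     e * f s x / eta x * expR (zeta * s) <= (sigma - zeta) * K) ->
  forall x, 0 <= x <= 1 -> e * u T x / eta x * expR (zeta * T) <= K.
Proof.
move=> K0 uinit ubdry fbd x x01; rewrite -subr_le0.
pose w s x := e * u s x / eta x * expR (zeta * s) - K.
pose wt s x :=
  e * (derive1 (u ^~ x) s + zeta * u s x) / eta x * expR (zeta * s).
have open01 (y : R) : 0 < y < 1 -> nbhs y (`]0, 1[ : set R).
  move=> y01; apply: open_nbhs_nbhs; split; first exact: interval_open.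
  by rewrite /= in_itv.
have clos01 (y : R) : 0 < y < 1 -> nbhs y (`[0, 1] : set R).
  move=> y01; apply: filterS (open01 y y01) => z /=; rewrite !in_itv/=.
  by move=> /andP[? ?]; apply/andP; split; exact: ltW.
have incl (y : R) : 0 < y < 1 -> 0 <= y <= 1.
  by move=> /andP[? ?]; apply/andP; split; exact: ltW.
have cexp (A : set R) : {within A `*` `[0, 1],
    continuous (fun p : R * R => expR (zeta * p.1))}.
  apply: continuous_subspaceT => p; apply: continuous_comp.
    by apply: cvgM; [exact: cvg_cst|exact: cvg_fst].
  exact: continuous_expR.
have ceta (A : set R) : {within A `*` `[0, 1],
    continuous (fun p : R * R => (eta p.2)^-1)}.
  have : {within A `*` `[0, 1], continuous (eta \o snd : R * R -> R)}.
    have ce : {within `[0, 1], continuous eta} by exact: (etaC2.2 0%N).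
    apply: (within_continuous_comp_maps ce); last by move=> p [].
    by apply: continuous_subspaceT => p; exact: cvg_snd.
  move=> h; rewrite continuous_subspace_in => p pA; apply: cvgV; last exact: h.
  rewrite gt_eqF//; apply: eta_gt0; move: pA; rewrite inE => -[_].
  by rewrite /= in_itv.
apply: (@parabolic_comparison R T (sigma - zeta) w wt) => //.
- by rewrite subr_gt0.
- move=> p; apply: cvgB; last exact: cvg_cst.
  apply: cvgM; last exact: cexp.
  apply: cvgM; last exact: ceta.
  by apply: cvgM; [exact: cvg_cst|exact: cu].
- have sub : `]0, T[ `*` `[0, 1] `<=` `[0, T] `*` `[0, 1 : R].
    by apply: setSX => r /=; rewrite !in_itv/= => /andP[? ?]; apply/andP; split; lra.
  move=> p; apply: cvgM; last exact: cexp.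
  apply: cvgM; last exact: ceta.
  apply: cvgM; first exact: cvg_cst.
  apply: cvgD; first exact: cdu.
  apply: cvgM; first exact: cvg_cst.
  exact: (continuous_subspaceW sub cu).
- move=> s y s0T y01.
  have ds : is_derive s 1 (u ^~ y) (derive1 (u ^~ y) s).
    by apply: DeriveDef; [exact: du|rewrite derive1E].
  have dexp : is_derive s 1 (expR \o ( *%R zeta)) (expR (zeta * s) * zeta).
    apply: is_derive1_comp.
    by have := is_deriveZ zeta (is_derive_id s 1); rewrite /GRing.scale/= mulr1.
  have dprod := is_deriveM (is_deriveZ (e / eta y) ds) dexp.
  have := is_deriveB dprod (is_derive_cst K s 1).
  rewrite subr0 => hw.
  have -> : w ^~ y = (e / eta y \*: (u^~ y)) * (expR \o *%R zeta) - cst K.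
    by apply/funext => r; congr (_ * _ - _); exact: mulrAC.
  apply: (is_derive_eq hw).
  rewrite /wt /GRing.scale/= /GRing.scale/=; ring.
- by move=> y y01; rewrite /w mulr0 expR0 mulr1 subr_le0 uinit.
- by move=> s s0T; rewrite /w subr_le0; apply: ubdry => //; left.
- by move=> s s0T; rewrite /w subr_le0; apply: ubdry => //; right.
- move=> p q p0 pq qT.
  have aeg : {ae lebesgue_measure, forall s : R, 0 < s < T ->
      classC 2 `]0, 1[ (u s) /\ forall x : R, 0 < x < 1 -> derive1 (u ^~ x) s =
      a s x * derive1n 2 (u s) x + b s x * derive1 (u s) x
      + c s x * u s x + f s x}.
    apply: (@filterS2 _ _ (ae_filter_ringOfSetsType lebesgue_measure)) uC2 pde.
    by move=> s h1 h2 s0T; split; [exact: h1|exact: h2].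
  have [s /andP[ps sq] hs] := ae_exists_itv aeg pq.
  have s0T : 0 < s < T by rewrite (le_lt_trans p0)// (lt_le_trans sq).
  exists s; first by rewrite ps.
  move: hs => /(_ s0T)[us2 us] y y01 wpos wmax.
  have etay : 0 < eta y by exact/eta_gt0/incl.
  have ex0 := expR_gt0 (zeta * s).
  have upos : 0 <= e * u s y.
    have : 0 < e * u s y / eta y * expR (zeta * s).
      by rewrite (le_lt_trans K0)// -subr_gt0.
    by rewrite pmulr_lgt0// pmulr_lgt0 ?invr_gt0//; exact: ltW.
  have umax z : 0 < z < 1 -> e * u s z / eta z <= e * u s y / eta y.
    move=> z01; have := wmax z (incl z z01).
    by rewrite /w lerD2r ler_pM2r.
  have dus (z : R) : 0 < z < 1 -> is_derive z 1 (e \*: u s) (e * derive1 (u s) z).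
    move=> z01; have [? _] := classC2_is_derive (open01 z z01) us2.
    exact: is_deriveZ.
  have d2us : is_derive y 1 (fun z => e * derive1 (u s) z) (e * derive1n 2 (u s) y).
    by have [_ ?] := classC2_is_derive (open01 y y01) us2; exact: is_deriveZ.
  have key := operator_at_weighted_max dus
    (fun z z01 => (classC2_is_derive (clos01 z z01) etaC2).1)
    (fun z z01 => eta_gt0 z (incl z z01)) y01 d2us
    (classC2_is_derive (clos01 y y01) etaC2).2 upos umax
    (a_ge0 s y s0T y01) (eta_super s y s0T y01).
  have fy := fbd s y s0T y01.
  rewrite /wt /w us//.
  set E := expR _ in fy ex0 *.
  have {}key : e * (a s y * derive1n 2 (u s) y + b s y * derive1 (u s) y
      + c s y * u s y) <= - sigma * (e * u s y).
    rewrite (_ : e * _ = a s y * (e * derive1n 2 (u s) y)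
      + b s y * (e * derive1 (u s) y) + c s y * (e * u s y)); first exact: key.
    ring.
  have g0 : 0 <= E / eta y by rewrite divr_ge0// ltW.
  have {}key := ler_wpM2r g0 key.
  (* the operator contributes at most [- sigma * e * u] and the source at most
     [(sigma - zeta) * K]; the exponential weight adds [zeta * e * u] *)
  rewrite -subr_ge0 in key; rewrite -subr_ge0 in fy; rewrite -subr_ge0.
  set L := a s y * _ + _ + _ in key *.
  rewrite (_ : _ - _ = (- sigma * (e * u s y) * (E / eta y) -
    e * L * (E / eta y)) +
    ((sigma - zeta) * K - e * f s y / eta y * E)); first exact: addr_ge0.
  ring.
- by rewrite lexx ltW.
Qed.

End one_sided_bound.

(** * Weighted norms and the two-sided estimate *)

Lemma wnorm_le {R : realType} {eta g : R -> R} {D : set R} {m : R} :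
  D !=set0 -> (forall x, D x -> `|g x| / eta x <= m) -> wnorm eta D g <= m.
Proof.
move=> [x0 Dx0] hm; apply: ge_sup; first by exists (`|g x0| / eta x0), x0.
by move=> _ [x Dx <-]; exact: hm.
Qed.

Lemma wnorm_ge {R : realType} {eta g : R -> R} {D : set R} {m x : R} :
  (forall y, D y -> `|g y| / eta y <= m) -> D x ->
  `|g x| / eta x <= wnorm eta D g.
Proof.
move=> hm Dx; apply: ub_le_sup; last by exists x.
by exists m => _ [y Dy <-]; exact: hm.
Qed.

(** Provides the upper bounds without which the suprema in the weighted norms
    would carry no information. *)
Lemma weighted_bound {R : realType} {eta : R -> R} (C : R) :
  {within `[0, 1], continuous eta} -> (forall x, 0 <= x <= 1 -> 0 < eta x) ->
  exists m, forall y x : R, 0 <= x <= 1 -> `|y| <= C -> `|y| / eta x <= m.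
Proof.
move=> ceta eta0; have [x0 + xmin] := EVT_min ler01 ceta.
rewrite in_itv/= => x001; exists (C / eta x0) => y x x01 yC.
apply: ler_pM => //; first by rewrite invr_ge0 ltW// eta0.
by rewrite lef_pV2 ?posrE ?eta0// xmin// in_itv.
Qed.

Theorem theorem2p1 (R : realType) (T : R) (hT : 0 < T)
    (a b c f u : R -> R -> R)
    (hf : exists M : R, forall t x : R,
            0 < t <= T -> 0 < x < 1 -> `|f t x| <= M)
    (hu : {within `[0, T] `*` `[0, 1], continuous (fun p : R * R => u p.1 p.2)})
    (hux : {ae lebesgue_measure, forall t : R,
              0 < t < T -> classC 2 `]0, 1[ (u t)})
    (hut : forall t x : R, 0 < t < T -> 0 <= x <= 1 -> derivable (u ^~ x) t 1)
    (hutc : {within `]0, T[ `*` `[0, 1],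
              continuous (fun p : R * R => derive1 (u ^~ p.2) p.1)})
    (hpde : {ae lebesgue_measure, forall t : R, 0 < t < T ->
              forall x : R, 0 < x < 1 ->
                derive1 (u ^~ x) t =
                a t x * derive1n 2 (u t) x + b t x * derive1 (u t) x
                + c t x * u t x + f t x})
    (ha : forall t x : R, 0 < t < T -> 0 < x < 1 -> 0 <= a t x)
    (sigma : R) (hsigma : 0 < sigma)
    (eta : R -> R) (heta : classC 2 `[0, 1] eta)
    (heta_pos : forall x : R, 0 <= x <= 1 -> 0 < eta x)
    (hineq : forall t x : R, 0 < t < T -> 0 < x < 1 ->
               a t x * derive1n 2 eta x + b t x * derive1 eta x
               + (sigma + c t x) * eta x <= 0)
    (zeta : R) (hzeta : 0 <= zeta < sigma) (t : R) (ht : 0 < t <= T) :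
  wnorm eta `[0, 1] (u t) <=
  Num.max (expR (- zeta * t) * wnorm eta `[0, 1] (u 0))
    (sup [set Num.max (Num.max (`|u s 0| / eta 0) (`|u s 1| / eta 1))
                (wnorm eta `]0, 1[ (f s) / (sigma - zeta))
              * expR (- zeta * (t - s)) | s in `]0, t]]).
Proof.
have [t0 tT] := andP ht; have [z0 zs] := andP hzeta.
have sz0 : 0 < sigma - zeta by rewrite subr_gt0.
have ceta : {within `[0, 1], continuous eta} by exact: (heta.2 0%N).
have in0t s : 0 < s < t -> 0 < s < T.
  by move=> /andP[s0 st]; rewrite s0 (lt_le_trans st).
have in00 : 0 <= (0 : R) <= 1 by rewrite lexx ler01.
have in01 : 0 <= (1 : R) <= 1 by rewrite lexx ler01.
have [Mu uM] : exists M, forall s x : R, 0 <= s <= T -> 0 <= x <= 1 -> `|u s x| <= M.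
  have [|||[s0 x0] _ mx] := @compact_EVT_max _ R
      (fun p : R * R => `|u p.1 p.2|) (`[0, T] `*` `[0, 1]).
  - by exists (0, 0); split; rewrite /= in_itv/= ?lexx ?ler01 ?ltW.
  - by apply: compact_setX; exact: segment_compact.
  - by move=> p; apply: cvg_norm; exact: hu.
  exists `|u s0 x0| => s x s0T x01.
  by apply: (mx (s, x)); rewrite inE; split; rewrite /= in_itv.
have [Mf fM] := hf.
have [mu umu] := weighted_bound Mu ceta heta_pos.
have [mf fmf] := weighted_bound Mf ceta heta_pos.
have fw s x : 0 < s <= t -> 0 < x < 1 -> `|f s x| / eta x <= mf.
  move=> /andP[s0 st] /andP[x0 x1]; apply: fmf; first by rewrite !ltW.
  by apply: fM; rewrite ?s0 ?x0 ?(le_trans st).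
have u0_le x : 0 <= x <= 1 -> `|u 0 x| / eta x <= wnorm eta `[0, 1] (u 0).
  move=> x01; apply: (@wnorm_ge _ _ _ _ mu); last by rewrite /= in_itv.
  move=> y; rewrite /= in_itv/= => y01; apply: umu => //.
  by apply: uM => //; rewrite lexx ltW.
set S := [set _ | s in _]; set rhs := Num.max _ _.
pose data s := Num.max (Num.max (`|u s 0| / eta 0) (`|u s 1| / eta 1))
  (wnorm eta `]0, 1[ (f s) / (sigma - zeta)).
have rhs0 : 0 <= rhs.
  rewrite /rhs le_max mulr_ge0 ?expR_ge0//.
  by apply: le_trans (u0_le 0 in00); rewrite divr_ge0// ltW// heta_pos.
have data_le s : 0 < s <= t -> data s * expR (- zeta * (t - s)) <= rhs.
  move=> st; rewrite /rhs le_max; apply/orP; right; apply: ub_le_sup; last first.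
    by exists s => //=; rewrite in_itv.
  exists (Num.max mu (mf / (sigma - zeta))) => _ [r + <-].
  rewrite /= in_itv/= => /andP[r0 rt]; rewrite -/(data r).
  have r0T : 0 <= r <= T by rewrite ltW// (le_trans rt).
  have data0 : 0 <= data r.
    by rewrite /data !le_max divr_ge0// ltW// heta_pos.
  apply: (@le_trans _ _ (data r)).
    rewrite ler_piMr// -expR0 ler_expR mulNr oppr_le0 mulr_ge0// subr_ge0//.
  rewrite /data !ge_max !le_max !umu ?uM//= ler_pM2r ?invr_gt0//.
  apply/orP; right; apply: wnorm_le.
    by exists (1 / 2) => /=; rewrite in_itv/=; apply/andP; split; lra.
  by move=> x; rewrite /= in_itv/= => x01; apply: fw => //; rewrite r0.
(* [rhs * expR (zeta * t)] is the constant that the time-weighted data never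
   exceed *)
have shift_le s y : 0 < s <= t -> y <= data s ->
    y * expR (zeta * s) <= rhs * expR (zeta * t).
  move=> st ys.
  have -> : expR (zeta * s) = expR (- zeta * (t - s)) * expR (zeta * t).
    by rewrite -expRD; congr expR; ring.
  rewrite mulrA ler_pM2r ?expR_gt0//; apply: le_trans (data_le s st).
  by rewrite ler_pM2r ?expR_gt0.
have side e x : `|e| = 1 -> 0 <= x <= 1 -> e * u t x / eta x <= rhs.
  move=> e1 x01; rewrite -(ler_pM2r (expR_gt0 (zeta * t))).
  have le_abs y (v : R) : 0 <= y <= 1 -> e * v / eta y <= `|v| / eta y.
    move=> y01; rewrite ler_pM2r ?invr_gt0 ?heta_pos//.
    by rewrite (le_trans (ler_norm _))// normrM e1 mul1r.
  (* the estimate at time [t] only sees earlier times, so [t] is the horizon *)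
  apply: (@one_sided_bound R t a b c f u eta sigma zeta) => //.
  - apply: continuous_subspaceW hu; apply: setSX => r //=.
    by rewrite !in_itv/= => /andP[-> /le_trans ->].
  - apply: (@filterS _ _ (ae_filter_ringOfSetsType lebesgue_measure)) hux.
    by move=> s h /in0t; exact: h.
  - by move=> s y /in0t; exact: hut.
  - apply: continuous_subspaceW hutc; apply: setSX => r //=.
    by rewrite !in_itv/=; exact: in0t.
  - apply: (@filterS _ _ (ae_filter_ringOfSetsType lebesgue_measure)) hpde.
    by move=> s h /in0t; exact: h.
  - by move=> s y /in0t; exact: ha.
  - by move=> s y /in0t; exact: hineq.
  - by rewrite mulr_ge0// expR_ge0.
  - move=> y y01; apply: le_trans (le_abs y _ y01) _.
    apply: le_trans (u0_le y y01) _.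
    rewrite -ler_pdivrMr ?expR_gt0// -expRN mulrC -mulNr.
    by rewrite /rhs le_max lexx.
  - move=> s y /andP[s0 st] y01; apply: shift_le; first by rewrite s0 ltW.
    have y01' : 0 <= y <= 1 by case: y01 => ->.
    apply: le_trans (le_abs y _ y01') _.
    by rewrite /data; case: y01 => ->; rewrite !le_max lexx ?orbT.
  - move=> s y /andP[s0 st] y01.
    have s0t : 0 < s <= t by rewrite s0 ltW.
    rewrite [leRHS]mulrC -ler_pdivrMr// mulrAC; apply: shift_le => //.
    rewrite /data le_max; apply/orP; right.
    rewrite ler_pM2r ?invr_gt0//.
    have y01' : 0 <= y <= 1 by case/andP: y01 => ? ?; rewrite !ltW.
    apply: le_trans (le_abs y _ y01') _.
    apply: (@wnorm_ge _ _ _ _ mf); last by rewrite /= in_itv.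
    by move=> z; rewrite /= in_itv/= => z01; exact: fw.
apply: wnorm_le; first by exists 0; rewrite /= in_itv.
move=> x; rewrite /= in_itv/= => x01.
have [uge|ult] := leP 0 (u t x).
  by rewrite ger0_norm//; have := side 1 x (normr1 _) x01; rewrite mul1r.
by rewrite ltr0_norm//; have := side (-1) x (normrN1 _) x01; rewrite mulN1r.
Qed.
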